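(* For every constant $C\ge 1$ there is a constant $c>0$ such that the following holds. For every number of cups $n$ and every $k$ with $1\le k\le Cn$, if the emptier follows the greedy emptying strategy in the negative-fill variable-processor cup game on $n$ cups (starting from all fills $0$), then no filler can achieve backlog $k$ within fewer than $c\left(k+\frac{k^3}{\log^2(n/k+2)}\right)$ rounds.
   Context: The negative-fill variable-processor cup game on $n$ cups: real fills $x_1,\dots,x_n$, initially $0$. In each round the filler chooses an integer $1\le p\le n$ and reals $a_i\in[0,1]$ with $\sum_i a_i=p$ and adds $a_i$ to cup $i$; then the emptier chooses $p$ distinct cups and subtracts exactly $1$ from each of their fills (fills may become negative). The backlog is $\max_i x_i$. The greedy emptier empties from the $p$ fullest cups after the filler's move. *)

(* Defs.v *)
From HB Require Import structures.
From mathcomp Require Import all_boot all_order all_algebra.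
From mathcomp Require Import reals exp.
Set Implicit Arguments. Unset Strict Implicit. Unset Printing Implicit Defensive.
Import Order.TTheory GRing.Theory Num.Theory.
Local Open Scope ring_scope.

Definition fills (R : realType) (n : nat) := 'I_n -> R.

Definition filler_move (R : realType) (n : nat) (p : nat) (a : fills R n) : Prop :=
  (1 <= p <= n)%N /\ (forall i, 0 <= a i <= 1) /\ \sum_(i < n) a i = p%:R.

(* Greedy emptier choice: S is a set of p cups that are the p fullest cups
   of the (post-filling) fills y, with arbitrary tie-breaking. *)
Definition greedy_choice (R : realType) (n : nat) (y : fills R n) (p : nat)
    (S : {set 'I_n}) : Prop :=
  #|S| = p /\ (forall i j, i \in S -> j \notin S -> y j <= y i).

Definition greedy_round (R : realType) (n : nat) (x x' : fills R n) : Prop :=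
  exists (p : nat) (a : fills R n) (S : {set 'I_n}),
    filler_move p a /\ greedy_choice (fun i => x i + a i) p S /\
    forall i, x' i = x i + a i - (i \in S)%:R.

(* A (possibly adaptive) play of the negative-fill variable-processor cup game
   against the greedy emptier, starting from all fills 0:
   xs t = fills after t complete rounds. *)
Definition greedy_play (R : realType) (n : nat) (xs : nat -> fills R n) : Prop :=
  (forall i, xs 0%N i = 0) /\ forall t, greedy_round (xs t) (xs t.+1).

(* Main.v *)
Require Import Defs.
From HB Require Import structures.
From mathcomp Require Import all_boot all_order all_algebra.
From mathcomp Require Import reals exp.
From mathcomp Require Import sequences ring lra.
Import Order.TTheory GRing.Theory Num.Theory.
Local Open Scope ring_scope.

(** Let F_t(h) be the sum over the cups of max(0, x_i - h). If m is the least
    filled level among the cups that greedy empties in a round, then F(h) does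
    not increase unless m - 1 < h < m; so among integer heights only one value
    of F can grow per round. The running maximum M_t(h) of F_t(h) is thus, for
    integer h, a convex nonincreasing sequence that starts at 0 and changes in
    at most one site per round.

    For such a process consider a block [a, a + 2e) and the weighted energy
    sum_j j^2 (M(a+j) - M(a+j+1))^2. A change by D at site a+j dissipates at
    least j^2 D^2 and creates at most 4 M(a) D, so the squares of all changes
    in the upper half of the block sum to at most 8 M(a)^2 / e, while the
    changes themselves sum to at least e M(a+2e). By Cauchy-Schwarz the block
    sees at least (e^3 / 8) (M(a+2e) / M(a))^2 changes. Splitting [0, k/2] into
    b ~ ln(n/k + 2) blocks with e ~ k / (4b), and using exp(x) >= 1 + x on the
    telescoping product of the ratios, gives order e^3 b ~ k^3 / b^2 rounds, as
    soon as the total ratio M(0) / M(k/2) is O(n/k).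

    Up to the first time a fill reaches k, M(0) <= 2 n k. The bound
    M(k/2) >= k^2 / 128 comes from integrality of the number of cups above a
    level: while F stays below the profile of a ladder with one rung per unit
    of height, a round cannot push it above that profile. *)

(** * Energy method for convex sequences growing at one site per step *)

Section ConvexGrowth.
Context {R : realType}.
Context (M : nat -> nat -> R).
Hypothesis M0 : forall h, M 0%N h = 0.
Hypothesis M_anti : forall t h, M t h.+1 <= M t h.
Hypothesis M_conv : forall t h, M t h.+1 - M t h.+2 <= M t h - M t h.+1.
Hypothesis M_mono : forall t h, M t h <= M t.+1 h.
Hypothesis M_site :
  forall t, exists h0, forall h, h != h0 -> M t.+1 h = M t h.

Let N t h := M t h - M t h.+1.
Let D t h := M t.+1 h - M t h.

Lemma growth_anti t h j : M t (h + j)%N <= M t h.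
Proof.
elim: j => [|j IH]; first by rewrite addn0.
by rewrite addnS; apply: le_trans (M_anti _ _) IH.
Qed.

Lemma growth_mono t s h : M t h <= M (t + s)%N h.
Proof.
elim: s => [|s IH]; first by rewrite addn0.
by rewrite addnS; apply: le_trans IH (M_mono _ _).
Qed.

Lemma growth_ge0 t h : 0 <= M t h.
Proof. by rewrite -(M0 h) -[t]add0n growth_mono. Qed.

(** By convexity each of the [j] drops between [a] and [a + j] is at least the drop at [a + j]. *)
Lemma slope_le t a j : j%:R * N t (a + j)%N <= M t a - M t (a + j)%N.
Proof.
elim: j => [|j IH]; first by rewrite addn0 mul0r subrr.
have := M_conv t (a + j); rewrite -!addnS /N addnS in IH * => c.
have j0 : 0 <= j%:R :> R by rewrite ler0n.
rewrite -!addnS in IH c *; rewrite -natr1.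
nra.
Qed.

(** Slopes decrease, so the difference is at most (2j+1) times the slope at [a + j.+1]; [slope_le]
    bounds [j.+1] times that slope by [B]. *)
Lemma weighted_slope_step t (a j : nat) (B : R) : M t a <= B ->
  j.+1%:R ^+ 2 * N t (a + j.+1)%N - j%:R ^+ 2 * N t (a + j)%N <= 2 * B.
Proof.
move=> aB; have s := slope_le t a j.+1.
have g := growth_ge0 t (a + j.+1).
have := M_conv t (a + j); rewrite -!addnS -/(N _ _) => c.
have n0 : 0 <= N t (a + j.+1)%N by rewrite /N subr_ge0.
have j0 : 0 <= j%:R :> R by rewrite ler0n.
have cj : j%:R ^+ 2 * N t (a + j.+1)%N <= j%:R ^+ 2 * N t (a + j)%N.
  by rewrite ler_wpM2l ?sqr_ge0 // /N -!addnS.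
rewrite -natr1 in s *; nra.
Qed.

(** Summation by parts: the difference moves from [D] to the weighted slopes, whose increments are
    at most [2 * B]. The boundary term is kept so that the induction on [d] closes. *)
Lemma abel_step t (a d : nat) (B : R) : M t.+1 a <= B ->
  \sum_(j < d.+1) j%:R ^+ 2 * N t.+1 (a + j)%N * (D t (a + j)%N - D t (a + j).+1)
    + d%:R ^+ 2 * N t.+1 (a + d)%N * D t (a + d).+1
  <= 2 * B * \sum_(j < d.+1) D t (a + j)%N.
Proof.
move=> aB; have D0 h : 0 <= D t h by rewrite subr_ge0.
have B0 : 0 <= B by apply: le_trans aB; apply: growth_ge0.
elim: d => [|d IH].
  by rewrite !big_ord1 expr0n !mul0r addr0 !mulr_ge0.
rewrite big_ord_recr [X in _ <= _ * X]big_ord_recr /=.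
have w := weighted_slope_step t.+1 a d B aB.
have := D0 (a + d.+1)%N; rewrite -addnS in IH * => Dd.
have := ler_wpM2r Dd w.
set S1 := \sum_(_ < _) _ in IH *; set S2 := \sum_(_ < _) _ in IH *.
rewrite -?addnS; lra.
Qed.

(** Adjacent changes have product zero, since only one site moves. Expanding the square of the old
    slope thus leaves pure squares of changes, plus a cross term handled by [abel_step]. *)
Lemma energy_step t (a d : nat) (B : R) : M t.+1 a <= B ->
  \sum_(j < d.+1) j%:R ^+ 2 * N t.+1 (a + j)%N ^+ 2
    + \sum_(j < d.+1) j%:R ^+ 2 * D t (a + j)%N ^+ 2
  <= \sum_(j < d.+1) j%:R ^+ 2 * N t (a + j)%N ^+ 2
    + 4 * B * \sum_(j < d.+1) D t (a + j)%N.
Proof.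
move=> aB; have D0 h : 0 <= D t h by rewrite subr_ge0.
have n0 : 0 <= N t.+1 (a + d)%N by rewrite /N subr_ge0.
have := abel_step t a d B aB.
have : 0 <= d%:R ^+ 2 * N t.+1 (a + d)%N * D t (a + d).+1.
  by rewrite !mulr_ge0 ?sqr_ge0.
have : \sum_(j < d.+1) j%:R ^+ 2 * N t.+1 (a + j)%N ^+ 2
    + \sum_(j < d.+1) j%:R ^+ 2 * D t (a + j)%N ^+ 2
  <= \sum_(j < d.+1) j%:R ^+ 2 * N t (a + j)%N ^+ 2
    + 2 * \sum_(j < d.+1) j%:R ^+ 2 * N t.+1 (a + j)%N
          * (D t (a + j)%N - D t (a + j).+1).
  rewrite mulr_sumr -!big_split /=; apply: ler_sum => j _.
  have DD : D t (a + j)%N * D t (a + j).+1 = 0.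
    have [h0 hs] := M_site t.
    have [e|ne] := eqVneq (a + j)%N h0.
      rewrite [D t (a + j).+1]/D hs ?subrr ?mulr0 // -e.
      by rewrite -addn1 -[X in _ != X]addn0 eqn_add2l.
    by rewrite [D t (a + j)%N]/D hs // subrr mul0r.
  have E : N t (a + j)%N = N t.+1 (a + j)%N - (D t (a + j)%N - D t (a + j).+1).
    by rewrite /N /D; ring.
  rewrite E; set x := N t.+1 _; set u := D t (a + j)%N in DD *.
  set v := D t _ in DD *; set w := j%:R ^+ 2.
  have w0 : 0 <= w by rewrite sqr_ge0.
  have -> : w * (x - (u - v)) ^+ 2 + 2 * (w * x * (u - v)) =
    w * x ^+ 2 + w * u ^+ 2 + w * v ^+ 2 - 2 * w * (u * v) by ring.
  rewrite DD mulr0 subr0 lerDl; nra.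
set S1 := \sum_(_ < _) _ * _ ^+ 2; lra.
Qed.

(** Telescopes [energy_step]: the energy starts at 0, and each site of the block grows by at most
    [M T a] in total. *)
Lemma energy_bound T (a d : nat) :
  \sum_(s < T) \sum_(j < d) j%:R ^+ 2 * D s (a + j)%N ^+ 2
  <= 4 * d%:R * M T a ^+ 2.
Proof.
case: d => [|d]; first by rewrite big1 ?mulr0 ?mul0r // => s _; rewrite big_ord0.
set B := M T a.
have B0 : 0 <= B by apply: growth_ge0.
suff H t : (t <= T)%N -> \sum_(j < d.+1) j%:R ^+ 2 * N t (a + j)%N ^+ 2 +
    \sum_(s < t) \sum_(j < d.+1) j%:R ^+ 2 * D s (a + j)%N ^+ 2
    <= 4 * B * \sum_(j < d.+1) M t (a + j)%N.
  have := H T (leqnn T).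
  have : 0 <= \sum_(j < d.+1) j%:R ^+ 2 * N T (a + j)%N ^+ 2.
    by apply: sumr_ge0 => j _; rewrite mulr_ge0 ?sqr_ge0.
  have : \sum_(j < d.+1) M T (a + j)%N <= d.+1%:R * B.
    apply: (@le_trans _ _ (\sum_(j < d.+1) B)).
      by apply: ler_sum => j _; apply: growth_anti.
    by rewrite sumr_const card_ord mulr_natl.
  move/(ler_wpM2l B0) => h1 h2 h3; lra.
elim: t => [|t IH] tT.
  rewrite big_ord0 addr0 big1 => [|j _]; last first.
    by rewrite /N !M0 subrr expr0n mulr0.
  by rewrite big1 ?mulr0 // => j _; rewrite M0.
have aB : M t.+1 a <= B by rewrite /B -(subnKC tT) growth_mono.
rewrite [X in _ + X <= _]big_ord_recr /=.
have := IH (ltnW tT); have := energy_step t a d B aB.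
have -> : \sum_(j < d.+1) D t (a + j)%N =
    \sum_(j < d.+1) M t.+1 (a + j)%N - \sum_(j < d.+1) M t (a + j)%N.
  by rewrite -sumrB.
lra.
Qed.

Lemma block_changes T (a e : nat) : (0 < e)%N -> 0 < M T (a + e.*2)%N ->
  e%:R ^+ 3 * (M T (a + e.*2)%N / M T a) ^+ 2 <=
  8 * \sum_(s < T) \sum_(j < e.*2) (M s.+1 (a + j)%N != M s (a + j)%N)%:R.
Proof.
move=> e0 Mpos; set B := M T a; set A := M T (a + e.*2)%N.
have B0 : 0 < B by apply: lt_le_trans Mpos (growth_anti _ _ _).
have en : 0 < e%:R :> R by rewrite ltr0n.
set K := \sum_(s < T) _.
(* Only the upper half of the block is kept, where the weight is at least e^2. *)
pose X := \sum_(s < T) \sum_(j < e.*2 | (e <= j)%N) D s (a + j)%N.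
pose Y := \sum_(s < T) \sum_(j < e.*2 | (e <= j)%N) D s (a + j)%N ^+ 2.
have HX : e%:R * A <= X.
  rewrite /X exchange_big /=.
  have -> : \sum_(j < e.*2 | (e <= j)%N) \sum_(s < T) D s (a + j)%N =
      \sum_(j < e.*2 | (e <= j)%N) M T (a + j)%N.
    apply: eq_bigr => j _.
    rewrite -(big_mkord xpredT (fun s => D s (a + j)%N)).
    by rewrite (telescope_sumr (fun s => M s (a + j)%N)) // M0 subr0.
  rewrite -(big_geq_mkord e e.*2 xpredT (fun j => M T (a + j)%N)) /=.
  apply: (@le_trans _ _ (\sum_(e <= j < e.*2) A)).
    by rewrite sumr_const_nat -addnn addnK mulr_natl.
  rewrite [X in _ <= X]big_nat big_nat; apply: ler_sum => j /andP[_ jd].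
  by rewrite /A -(subnKC (ltnW jd)) addnA growth_anti.
have HY : e%:R * Y <= 8 * B ^+ 2.
  rewrite -(ler_pM2l en); apply: le_trans (_ : 4 * e.*2%:R * B ^+ 2 <= _).
    apply: le_trans (energy_bound T a e.*2).
    rewrite mulrA -expr2 /Y mulr_sumr; apply: ler_sum => s _.
    rewrite mulr_sumr big_mkcond /=; apply: ler_sum => j _.
    case: ifP => [ej|_]; last by rewrite mulr_ge0 ?sqr_ge0.
    by rewrite ler_wpM2r ?sqr_ge0 // lerXn2r ?nnegrE ?ler0n // ler_nat.
  by rewrite -muln2 natrM; rewrite le_eqVlt; apply/orP; left; apply/eqP; ring.
(* Cauchy-Schwarz in linearised form; [l] is chosen optimally below. *)
have HC l : 2 * l * X <= Y + l ^+ 2 * K.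
  rewrite /X /Y /K !mulr_sumr -big_split /=; apply: ler_sum => s _.
  rewrite big_mkcond [X in _ <= X + _]big_mkcond /= !mulr_sumr -big_split /=.
  apply: ler_sum => j _; case: ifP => [_|_]; last first.
    by rewrite mulr0 add0r mulr_ge0 ?sqr_ge0 ?ler0n.
  case: eqVneq => [E|_] /=; rewrite ?mulr1.
    by rewrite /D E subrr expr0n !mulr0 addr0.
  by rewrite -subr_ge0; have := sqr_ge0 (D s (a + j)%N - l); lra.
have [c1 c2] : e%:R != 0 :> R /\ A != 0 by rewrite !gt_eqF.
have c3 : B != 0 by rewrite gt_eqF.
(* This [l] is the upper bound 8 B^2 / e on [Y] divided by the lower bound e A on [X], so
   [2 * l * X] is at least twice the bound on [Y]. *)
have := HC (8 * B ^+ 2 / (e%:R ^+ 2 * A)).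
set l := _ / _ => Hl.
have l0 : 0 < l by rewrite !(divr_gt0, mulr_gt0, exprn_gt0).
have h1 : 16 * B ^+ 2 / e%:R <= 2 * l * X.
  have -> : 16 * B ^+ 2 / e%:R = 2 * l * (e%:R * A) by rewrite /l; field; rewrite ?c1 ?c2 ?c3.
  by rewrite ler_wpM2l // mulr_ge0 // ltW.
have h2 : Y <= 8 * B ^+ 2 / e%:R by rewrite ler_pdivlMr // mulrC.
have h3 : 8 * B ^+ 2 / e%:R <= l ^+ 2 * K.
  have : 16 * B ^+ 2 / e%:R = 8 * B ^+ 2 / e%:R + 8 * B ^+ 2 / e%:R by ring.
  lra.
have -> : 8 * K = e%:R ^+ 4 * A ^+ 2 / (8 * B ^+ 4) * (l ^+ 2 * K).
  by rewrite /l; field; rewrite ?c1 ?c2 ?c3.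
apply: le_trans (ler_wpM2l _ h3); last first.
  by rewrite ltW // !(divr_gt0, mulr_gt0, exprn_gt0).
by rewrite le_eqVlt; apply/orP; left; apply/eqP; field; rewrite ?c1 ?c2 ?c3.
Qed.

Lemma sum_blocks (f : nat -> R) (d b : nat) :
  \sum_(i < b) \sum_(j < d) f (i * d + j)%N = \sum_(h < b * d) f h.
Proof.
elim: b => [|b IH]; first by rewrite mul0n !big_ord0.
by rewrite big_ord_recr /= IH mulSnr big_split_ord.
Qed.

Lemma changes_le1 s (d : nat) : \sum_(h < d) (M s.+1 h != M s h)%:R <= 1 :> R.
Proof.
have [h0 hs] := M_site s.
apply: (@le_trans _ _ (\sum_(h < d) (val h == h0)%:R)).
  apply: ler_sum => h _; have [_|ne] := eqVneq (val h) h0.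
    by rewrite ler_nat leq_b1.
  by rewrite hs // eqxx.
have [lt|ge] := ltnP h0 d; last first.
  rewrite big1 // => h _; case: eqP => // E.
  by move: (ltn_ord h); rewrite E ltnNge ge.
rewrite (bigD1 (Ordinal lt)) //= eqxx big1 ?addr0 // => h.
by rewrite -val_eqE /= => /negbTE ->.
Qed.

Lemma growth_time T (e b : nat) (K : R) : (0 < e)%N -> 0 < M T (b * e.*2)%N ->
  ln (M T 0%N) - ln (M T (b * e.*2)%N) <= K * b%:R ->
  e%:R ^+ 3 * b%:R <= 8 * expR (2 * K) * T%:R.
Proof.
move=> e0 Mp Hln.
have pos i : (i <= b)%N -> 0 < M T (i * e.*2)%N.
  move=> ib; apply: lt_le_trans Mp _.
  by rewrite -(subnKC ib) mulnDl growth_anti.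
pose th i := M T (i.+1 * e.*2)%N / M T (i * e.*2)%N.
have HT : e%:R ^+ 3 * \sum_(i < b) th i ^+ 2 <= 8 * T%:R.
  apply: (@le_trans _ _ (8 * \sum_(s < T) \sum_(i < b) \sum_(j < e.*2)
     (M s.+1 (i * e.*2 + j)%N != M s (i * e.*2 + j)%N)%:R)).
    rewrite exchange_big /= !mulr_sumr; apply: ler_sum => i _.
    have := block_changes T (i * e.*2) e e0.
    by rewrite /th mulSnr; apply; rewrite -mulSnr pos.
  rewrite ler_wpM2l //; apply: (@le_trans _ _ (\sum_(s < T) 1)); last first.
    by rewrite sumr_const card_ord.
  apply: ler_sum => s _.
  by rewrite (sum_blocks (fun h => (M s.+1 h != M s h)%:R)) changes_le1.
have Hth : b%:R <= expR (2 * K) * \sum_(i < b) th i ^+ 2.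
  (* Apply 1 + x <= exp x with x = 2K + 2 ln (th i). The logarithms telescope, and the hypothesis on
     their total makes these x sum to at least 0. *)
  have : \sum_(i < b) (1 + (2 * K + 2 * (ln (M T (i.+1 * e.*2)%N) - ln (M T (i * e.*2)%N))))
      <= expR (2 * K) * \sum_(i < b) th i ^+ 2.
    rewrite mulr_sumr; apply: ler_sum => i _.
    apply: le_trans (expR_ge1Dx _) _.
    have [p1 p2] : 0 < M T (i.+1 * e.*2)%N /\ 0 < M T (i * e.*2)%N.
      by rewrite !pos // ltnW.
    rewrite expRD ler_pM2l ?expR_gt0 // -lnV ?posrE // -lnM ?posrE ?invr_gt0 //.
    by rewrite -/(th i) expRM_natl lnK // posrE divr_gt0.
  apply: le_trans.
  rewrite !big_split /= !sumr_const card_ord -mulr_sumr.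
  rewrite -(big_mkord xpredT (fun i => ln (M T (i.+1 * e.*2)%N) - ln (M T (i * e.*2)%N))).
  rewrite (telescope_sumr (fun i => ln (M T (i * e.*2)%N))) // mul0n.
  rewrite -mulr_natr; lra.
have e3 : 0 <= e%:R ^+ 3 :> R by rewrite exprn_ge0.
apply: le_trans (ler_wpM2l e3 Hth) _.
rewrite mulrCA -mulrA mulrCA [X in _ <= X]mulrC -?mulrA.
have := ler_wpM2l (ltW (expR_gt0 (2 * K))) HT; lra.
Qed.

End ConvexGrowth.

(** * Overshoot above a level and the ladder barrier *)

Section Overshoot.
Context {R : realType}.

Definition pos_part (z : R) : R := Num.max 0 z.

Lemma pos_part_ge0 z : 0 <= pos_part z. Proof. by rewrite le_max lexx. Qed.
Lemma pos_part_ge z : z <= pos_part z. Proof. by rewrite le_max lexx orbT. Qed.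
Lemma pos_part_le z w : 0 <= w -> z <= w -> pos_part z <= w.
Proof. by move=> ? ?; rewrite ge_max; apply/andP. Qed.
Lemma pos_part_eq0 z : z <= 0 -> pos_part z = 0.
Proof. by move=> z0; apply/eqP; rewrite eq_le pos_part_ge0 pos_part_le. Qed.
Lemma pos_partE z : 0 <= z -> pos_part z = z.
Proof. by move=> z0; apply/eqP; rewrite eq_le pos_part_ge pos_part_le. Qed.

Definition overshoot {n} (x : 'I_n -> R) (h : R) : R := \sum_(i < n) pos_part (x i - h).
Definition above {n} (x : 'I_n -> R) (h : R) : nat := \sum_(i < n) (h < x i)%R.

Lemma overshoot_ge0 n (x : 'I_n -> R) h : 0 <= overshoot x h.
Proof. by apply: sumr_ge0 => i _; apply: pos_part_ge0. Qed.

Lemma overshoot_ge n (x : 'I_n -> R) h i : x i - h <= overshoot x h.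
Proof.
rewrite /overshoot (bigD1 i) //=; apply: le_trans (pos_part_ge _) _.
by rewrite lerDl sumr_ge0 // => j _; apply: pos_part_ge0.
Qed.

Lemma overshoot_anti n (x : 'I_n -> R) h u : h <= u -> overshoot x u <= overshoot x h.
Proof.
move=> hu; apply: ler_sum => i _; apply: pos_part_le; first exact: pos_part_ge0.
by apply: le_trans (pos_part_ge _); lra.
Qed.

Lemma overshoot_conv n (x : 'I_n -> R) h :
  overshoot x (h + 1) - overshoot x (h + 2) <= overshoot x h - overshoot x (h + 1).
Proof.
rewrite /overshoot -!sumrB; apply: ler_sum => i _.
have := pos_part_ge0 (x i - h); have := pos_part_ge (x i - h).
have := pos_part_ge0 (x i - (h + 2)); have := pos_part_ge (x i - (h + 2)).
have [l|l] := leP 0 (x i - (h + 1));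
  [rewrite [pos_part (x i - (h + 1))]pos_partE //
  |rewrite [pos_part (x i - (h + 1))]pos_part_eq0]; lra.
Qed.

Lemma overshoot_slope_ge n (x : 'I_n -> R) u h : u <= h ->
  overshoot x h + (above x h)%:R * (h - u) <= overshoot x u.
Proof.
move=> uh; rewrite /above natr_sum mulr_suml /overshoot -big_split /=.
apply: ler_sum => i _; case: ltP => hx /=.
  by rewrite mul1r !pos_partE; lra.
by rewrite mul0r addr0 pos_part_eq0 ?pos_part_ge0 ?subr_le0.
Qed.

Lemma overshoot_slope_le n (x : 'I_n -> R) u h : u <= h ->
  overshoot x u <= overshoot x h + (above x u)%:R * (h - u).
Proof.
move=> uh; rewrite /above natr_sum mulr_suml /overshoot -big_split /=.
apply: ler_sum => i _; case: ltP => hx /=.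
  have := pos_part_ge (x i - h); rewrite mul1r (@pos_partE (x i - u)); lra.
by rewrite mul0r addr0 pos_part_eq0 ?pos_part_ge0 ?subr_le0.
Qed.

(** At [h >= m] the cups left alone contribute nothing afterwards, by greediness, and the emptied
    ones do not gain. At [h <= m - 1] the emptied cups end at or above [h], so each loses its full
    unit, and these [p] units offset the fill added. *)
Lemma round_overshoot n (x x' : fills R n) : greedy_round x x' ->
  exists m, forall h, h <= m - 1 \/ m <= h -> overshoot x' h <= overshoot x h.
Proof.
move=> [p] [a] [S] [[/andP[p1 _] [a01 asum]]] [[cS gS] Hx'].
have /card_gt0P[i0 i0S] : (0 < #|S|)%N by rewrite cS.
have [m [mS [im [imS mE]]]] : exists m, (forall i, i \in S -> m <= x i + a i) /\
    exists im, im \in S /\ m = x im + a im.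
  case: (arg_minP (fun i => x i + a i) i0S) => im imS min.
  by exists (x im + a im); split=> //; exists im.
exists m => h [hm|mh]; last first.
  apply: ler_sum => i _; rewrite Hx'; have /andP[a0 a1] := a01 i.
  case: (boolP (i \in S)) => iS /=.
    by apply: pos_part_le; rewrite ?pos_part_ge0 //; apply: le_trans (pos_part_ge _); lra.
  by rewrite pos_part_eq0 ?pos_part_ge0 //; have := gS _ _ imS iS; lra.
have Sp : \sum_(i < n) ((i \in S)%:R : R) = p%:R.
  by rewrite -natr_sum -cS -sum1_card [in RHS]big_mkcond /=; congr _%:R.
have -> : overshoot x h = \sum_(i < n) (pos_part (x i - h) + a i - (i \in S)%:R).
  by rewrite sumrB big_split /= asum Sp addrK.
apply: ler_sum => i _; rewrite Hx'; have /andP[a0 a1] := a01 i.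
have := pos_part_ge (x i - h); have := pos_part_ge0 (x i - h).
case: (boolP (i \in S)) => iS /= p0 pg.
  by rewrite pos_partE; have := mS _ iS; lra.
by apply: pos_part_le; lra.
Qed.

Lemma window_site (m : R) :
  exists h0 : nat, forall h : nat, h != h0 -> h%:R <= m - 1 \/ m <= h%:R.
Proof.
have [m0|m0] := leP m 0.
  (* No natural number lies below [m] here, so the site is arbitrary. *)
  by exists 0%N => h _; right; apply: le_trans m0 _.
have ex : exists h : nat, m <= h%:R.
  have /andP[_ /ltW lt] := Num.Theory.truncn_itv (ltW m0).
  by exists (Num.truncn m).+1.
case: (ex_minnP ex) => h1 mh1 min; exists h1.-1 => h.
rewrite neq_ltn => /orP[lt|gt]; [left|right].
  have h1p : h1.-1%:R < m :> R.
    rewrite ltNge; apply/negP => /min.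
    by case: h1 lt {mh1 min} => [|h1] //=; rewrite ltnn.
  have : (h.+1)%:R <= h1.-1%:R :> R by rewrite ler_nat.
  rewrite -natr1; lra.
apply: le_trans mh1 _; rewrite ler_nat.
by apply: leq_trans (leqSpred h1) gt.
Qed.

(** The lowest rung is at [h0 + 2], leaving [h0, h0 + 1] to be controlled directly by the overshoot
    at [h0]. *)
Definition ladder (h0 : R) (J : nat) (j : 'I_J) : R := h0 + 2 + j%:R.

(** Shifting by one unit sends each rung except the last to the next rung. *)
Lemma ladder_step h0 J u :
  (above (ladder h0 J) u <= (above (ladder h0 J) (u + 1)).+1)%N.
Proof.
case: J => [|J]; first by rewrite /above !big_ord0.
rewrite {1}/above big_ord_recr [in X in (_ <= X)%N]/above big_ord_recl /=.
have -> : (\sum_(i < J) (u < ladder h0 J.+1 (widen_ord (leqnSn J) i))%R =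
  \sum_(i < J) (u + 1 < ladder h0 J.+1 (lift ord0 i))%R)%N.
  apply: eq_bigr => i _; congr (nat_of_bool _).
  by rewrite /ladder /= /bump /= add1n -natr1; apply/idP/idP; lra.
by rewrite addnC -addSn leq_add2r (leq_trans (leq_b1 _)).
Qed.

Lemma ladder_overshoot h0 J : (J * J)%:R / 2 <= overshoot (ladder h0 J) (h0 + 1).
Proof.
rewrite /overshoot; elim: J => [|J IH]; first by rewrite big_ord0 mul0r.
rewrite big_ord_recr /=.
have -> : \sum_(i < J) pos_part (ladder h0 J.+1 (widen_ord (leqnSn J) i) - (h0 + 1)) =
   \sum_(i < J) pos_part (ladder h0 J i - (h0 + 1)) by [].
have := pos_part_ge (ladder h0 J.+1 ord_max - (h0 + 1)).
rewrite /ladder /= in IH *.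
have -> : (J.+1 * J.+1)%:R = (J * J)%:R + 2 * J%:R + 1 :> R by rewrite !natrM -natr1; ring.
lra.
Qed.

(* The number of cups above a level is an integer, so no profile can rise above
   a profile with one rung per unit of height inside a window of length 1. *)
Lemma window_barrier n (x : 'I_n -> R) h0 J m h : m - 1 <= h <= m ->
  overshoot x (m - 1) <= overshoot (ladder h0 J) (m - 1) ->
  overshoot x m <= overshoot (ladder h0 J) m ->
  overshoot x h <= overshoot (ladder h0 J) h.
Proof.
move=> /andP[mh hm] Hl Hr; set Q := ladder h0 J in Hl Hr *.
have := ladder_step h0 J (m - 1); rewrite subrK -/Q => st.
(* With many cups above [h], compare slopes from the left end [m - 1]. Otherwise integrality and
   [ladder_step] allow at most as many cups as rungs above [m], and the comparison runs from the
   right end. *)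
have [le|lt] := leqP (above Q (m - 1)) (above x h).
  have := overshoot_slope_ge _ x _ _ mh; have := overshoot_slope_le _ Q _ _ mh.
  have : (above Q (m - 1))%:R <= (above x h)%:R :> R by rewrite ler_nat.
  have : 0 <= h - (m - 1) by lra.
  by move=> s0 /(ler_wpM2r s0); lra.
have {}lt : (above x h <= above Q m)%N by rewrite -ltnS; apply: leq_trans lt st.
have := overshoot_slope_ge _ Q _ _ hm; have := overshoot_slope_le _ x _ _ hm.
have : (above x h)%:R <= (above Q m)%:R :> R by rewrite ler_nat.
have : 0 <= m - h by lra.
by move=> s0 /(ler_wpM2r s0); lra.
Qed.

Lemma play_barrier n (xs : nat -> fills R n) (h0 : R) (J T : nat) :
  0 <= h0 -> greedy_play xs ->
  (forall t, (t <= T)%N -> overshoot (xs t) h0 <= (J * J)%:R / 2) ->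
  forall h, h0 <= h -> overshoot (xs T) h <= overshoot (ladder h0 J) h.
Proof.
move=> h00 [x0 xr]; elim: T => [|T IH] HB h hh.
  rewrite /overshoot big1 ?overshoot_ge0 // => i _.
  by rewrite pos_part_eq0 // x0; lra.
have {}IH := IH (fun t tT => HB t (leqW tT)).
have base u : h0 <= u <= h0 + 1 -> overshoot (xs T.+1) u <= overshoot (ladder h0 J) u.
  move=> /andP[u0 u1]; apply: le_trans (overshoot_anti _ _ _ _ u0) _.
  apply: le_trans (HB _ (leqnn _)) _.
  by apply: le_trans (ladder_overshoot h0 J) (overshoot_anti _ _ _ _ u1).
have [m Hm] := round_overshoot _ _ _ (xr T).
have [h1|h1] := leP h (h0 + 1); first by rewrite base // hh.
have [l|l] := leP h (m - 1); first by apply: le_trans (Hm _ (or_introl l)) (IH _ hh).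
have [r|r] := leP m h; first by apply: le_trans (Hm _ (or_intror r)) (IH _ hh).
apply: (window_barrier _ _ _ _ m); first by rewrite !ltW.
(* As [h0 + 1 < h < m], the left end of the window lies above [h0], within reach of the induction
   hypothesis. *)
- have [u|u] := leP h0 (m - 1).
    by apply: le_trans (Hm _ (or_introl (lexx _))) (IH _ u).
  by move: h1 u r; lra.
- by apply: le_trans (Hm _ (or_intror (lexx _))) (IH _ _); lra.
Qed.

(** Otherwise the ladder barrier holds up to time [T]; its overshoot vanishes at its top rung
    [h0 + 1 + J], so no fill could exceed that height. *)
Lemma overshoot_of_backlog n (xs : nat -> fills R n) (h0 : R) (J T : nat) i :
  0 <= h0 -> greedy_play xs -> h0 + 1 + J%:R < xs T i ->
  exists2 t, (t <= T)%N & (J * J)%:R / 2 <= overshoot (xs t) h0.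
Proof.
move=> h00 pl big.
have [/existsP[t Ht]|/existsPn none] :=
  boolP [exists t : 'I_T.+1, (J * J)%:R / 2 <= overshoot (xs t) h0].
  by exists t => //; rewrite -ltnS.
have HB t : (t <= T)%N -> overshoot (xs t) h0 <= (J * J)%:R / 2.
  by move=> tT; have := none (Ordinal (tT : (t < T.+1)%N)); rewrite -ltNge => /ltW.
have h1 : h0 <= h0 + 1 + J%:R by have := ler0n R J; lra.
have := play_barrier n xs h0 J T h00 pl HB _ h1.
have := overshoot_ge _ (xs T) (h0 + 1 + J%:R) i.
have -> : overshoot (ladder h0 J) (h0 + 1 + J%:R) = 0; last by lra.
rewrite /overshoot big1 // => j _; rewrite pos_part_eq0 // /ladder.
have : (j.+1)%:R <= J%:R :> R by rewrite ler_nat.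
rewrite -natr1; lra.
Qed.

End Overshoot.

(** * The running maximum of the overshoot along a play *)

Section Play.
Context {R : realType} {n : nat} {xs : nat -> fills R n}.
Hypothesis play : greedy_play xs.

Lemma fill_step t i : xs t.+1 i <= xs t i + 1.
Proof.
have [p [a [S [[_ [a01 _]] [_ ->]]]]] := play.2 t.
by have /andP[_ ?] := a01 i; case: (i \in S) => /=; lra.
Qed.

Lemma fill_le_time t i : xs t i <= t%:R.
Proof.
elim: t => [|t IH]; first by rewrite play.1.
by rewrite -natr1; apply: le_trans (fill_step _ _) _; rewrite lerD2r.
Qed.

(** The initial value 0 is the overshoot of empty cups at natural heights. *)
Fixpoint peak (t h : nat) : R :=
  if t is s.+1 then Num.max (peak s h) (overshoot (xs t) h%:R) else 0.

Lemma peak_mono t h : peak t h <= peak t.+1 h.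
Proof. by rewrite /= le_max lexx. Qed.

Lemma peak_anti t h : peak t h.+1 <= peak t h.
Proof.
elim: t => [|t IH] //=; rewrite ge_max !le_max IH /= overshoot_anti ?orbT //.
by rewrite ler_nat.
Qed.

(** A maximum of convex sequences is convex: the middle maximum is attained by one sequence, whose
    outer values lie below the outer maxima. *)
Lemma peak_conv t h :
  peak t h.+1 - peak t h.+2 <= peak t h - peak t h.+1.
Proof.
elim: t => [|t IH] //=.
set y := xs t.+1; have := overshoot_conv _ y h%:R.
have -> : h%:R + 1 = h.+1%:R :> R by rewrite natr1.
have -> : h%:R + 2 = h.+2%:R :> R by rewrite -[h.+2]addn2 natrD.
have maxl (u v : R) : u <= Num.max u v by rewrite le_max lexx.
have maxr (u v : R) : v <= Num.max u v by rewrite le_max lexx orbT.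
have := maxl (peak t h) (overshoot y h%:R).
have := maxr (peak t h) (overshoot y h%:R).
have := maxl (peak t h.+2) (overshoot y h.+2%:R).
have := maxr (peak t h.+2) (overshoot y h.+2%:R).
have [l|l] := leP (peak t h.+1) (overshoot y h.+1%:R); lra.
Qed.

Lemma overshoot_le_peak s t h : (s <= t)%N -> overshoot (xs s) h%:R <= peak t h.
Proof.
elim: t => [|t IH]; rewrite ?leqn0.
  move/eqP=> ->; rewrite /overshoot big1 // => i _.
  by rewrite play.1 pos_part_eq0 // sub0r oppr_le0.
rewrite leq_eqVlt => /predU1P[->|st]; first by rewrite /= le_max lexx orbT.
exact: le_trans (IH st) (peak_mono _ _).
Qed.

Lemma peak_site t : exists h0, forall h, h != h0 -> peak t.+1 h = peak t h.
Proof.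
have [m Hm] := round_overshoot _ _ _ (play.2 t).
have [h0 H0] := window_site m; exists h0 => h /H0/Hm le /=.
by apply/max_idPl; apply: le_trans le (overshoot_le_peak _ _ _ _).
Qed.

Lemma peak_le t h (B : R) : 0 <= B ->
  (forall s, (s <= t)%N -> overshoot (xs s) h%:R <= B) -> peak t h <= B.
Proof.
move=> B0; elim: t => [|t IH] H //=; rewrite ge_max H // andbT.
by apply: IH => s st; apply/H/leqW.
Qed.

Lemma peak_time T (e b : nat) (K : R) : (0 < e)%N -> 0 < peak T (b * e.*2)%N ->
  ln (peak T 0%N) - ln (peak T (b * e.*2)%N) <= K * b%:R ->
  e%:R ^+ 3 * b%:R <= 8 * expR (2 * K) * T%:R.
Proof.
exact: (growth_time peak (fun=> erefl) peak_anti peak_conv peak_mono peak_site).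
Qed.

End Play.

(** * Choice of block sizes and constants *)

Lemma ln2_ge (R : realType) : 2^-1 <= ln 2 :> R.
Proof.
have : ln (1 + - 2^-1) <= - 2^-1 :> R by apply: le_ln1Dx; lra.
have -> : 1 + - 2^-1 = 2^-1 :> R by field.
rewrite lnV ?posrE //; lra.
Qed.

Lemma first_backlog_time (R : realType) (n : nat) (k : R) (xs : nat -> fills R n) t i :
  8 <= k -> greedy_play xs -> k <= xs t i ->
  (forall s j, (s < t)%N -> xs s j < k) ->
  k ^+ 3 / ln (n%:R / k + 2) ^+ 2 <= 192 ^+ 2 * expR 18 * t%:R.
Proof.
move=> k8 pl kx first.
set l := ln _.
have kt : k <= t%:R by apply: le_trans kx (fill_le_time pl _ _).
have n1 : 1 <= n%:R :> R by rewrite ler1n; apply: leq_ltn_trans (ltn_ord i).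
have nk0 : 0 < n%:R / k by rewrite divr_gt0; lra.
have l2 : ln 2 <= l by rewrite /l ler_ln ?posrE; lra.
have lh : 2^-1 <= l by apply: le_trans (ln2_ge R) l2.
have l0 : 0 <= l by lra.
have /andP[b1 b2] := Num.Theory.truncn_itv l0.
set b := (Num.truncn l).+1 in b2.
(* Uses b <= l + 1 and l >= 1/2. *)
have b3 : b%:R <= 3 * l by rewrite /b -natr1; lra.
have b0 : 0 < b%:R :> R by rewrite ltr0n.
have lb2 : 0 < l ^+ 2 by rewrite exprn_gt0; lra.
have E1 : 1 <= expR 18 :> R by apply: le_trans (expR_ge1Dx _); lra.
rewrite ler_pdivrMr //.
(* If blocks of size k / (4b) would be empty, then k < 12 l and the trivial bound k <= t
   suffices. *)
have [kb|kb] := ltP k (4 * b%:R).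
  have k12 : k ^+ 2 <= 144 * l ^+ 2.
    rewrite (_ : 144 * _ = (12 * l) ^+ 2); last by ring.
    by rewrite lerXn2r ?nnegrE; lra.
  have := ler_pM (ltac:(lra) : 0 <= k) (sqr_ge0 k) kt k12.
  rewrite -exprS => h; apply: le_trans h _.
  have t0 : 0 <= t%:R * l ^+ 2 by rewrite mulr_ge0 // ltW.
  have := ler_wpM2r t0 E1; lra.
have kb0 : 0 <= k / (4 * b%:R) by rewrite divr_ge0; lra.
have /andP[e1 e2] := Num.Theory.truncn_itv kb0.
set e := Num.truncn _ in e1 e2.
have ke1 : 1 <= k / (4 * b%:R) by rewrite ler_pdivlMr; lra.
have e0 : (0 < e)%N by rewrite Num.Theory.truncn_gt0.
have e1n : 1 <= e%:R :> R by rewrite ler1n.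
have ek : 4 * b%:R * e%:R <= k by move: e1; rewrite ler_pdivlMr; lra.
have ek2 : k <= 8 * b%:R * e%:R.
  by move: e2; rewrite -(natr1 e) ltr_pdivrMr; [nra|lra].
have k40 : 0 <= k / 4 by lra.
have /andP[j1 j2] := Num.Theory.truncn_itv k40.
set J := Num.truncn _ in j1 j2.
have J8 : k / 8 <= J%:R by rewrite -(natr1 J) in j2; lra.
have hE : (b * e.*2)%:R = 2 * b%:R * e%:R :> R by rewrite -muln2 !natrM; ring.
(* The base height 2be is at most k/2 and J <= k/4, so 2be + 1 + J < k because k >= 8. *)
have [s st Hs] : exists2 s, (s <= t)%N & (J * J)%:R / 2 <= overshoot (xs s) (b * e.*2)%:R.
  by apply: (overshoot_of_backlog _ _ _ _ _ i) => //; rewrite hE; lra.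
have P1 : k ^+ 2 / 128 <= peak (xs := xs) t (b * e.*2)%N.
  apply: le_trans (overshoot_le_peak pl _ _ _ st); apply: le_trans Hs.
  rewrite natrM; nra.
(* Fills are below k before round [t], and one round adds at most 1, so they never exceed 2k. *)
have P0 : peak (xs := xs) t 0%N <= 2 * n%:R * k.
  apply: peak_le => [|s' s't]; first by rewrite !mulr_ge0; lra.
  apply: (@le_trans _ _ (\sum_(j < n) (2 * k))).
    apply: ler_sum => j _; apply: pos_part_le; first lra.
    rewrite subr0; have [lt|eq] : (s' < t)%N \/ s' = t.
      by move: s't; rewrite leq_eqVlt => /predU1P[]; [right|left].
      by have := first _ j lt; lra.
    case: s' s't eq => [|s'] _ E; first by rewrite pl.1; lra.
    have := fill_step pl s' j; have := first s' j.
    by rewrite -E ltnSn => /(_ isT); lra.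
  by rewrite sumr_const card_ord -mulr_natr; lra.
have k2 : 0 < k ^+ 2 / 128 by rewrite divr_gt0 ?exprn_gt0; lra.
have Pp := lt_le_trans k2 P1.
have Pp0 : 0 < peak (xs := xs) t 0%N.
  by apply: lt_le_trans Pp _; apply: (growth_anti _ (@peak_anti _ _ xs) t 0).
have := peak_time pl t e b 9 e0 Pp.
(* The ratio of the peaks is at most 2^8 n/k, and l + 8 ln 2 <= 9 l <= 9 b. *)
have ln_le : ln (peak (xs := xs) t 0%N) - ln (peak (xs := xs) t (b * e.*2)%N) <= 9 * b%:R.
  rewrite -ln_div ?posrE //.
  apply: (@le_trans _ _ (ln ((n%:R / k + 2) * 2 ^+ 8))).
    rewrite ler_ln ?posrE ?divr_gt0 //; last by apply: mulr_gt0; lra.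
    rewrite ler_pdivrMr //; apply: le_trans P0 _.
    have -> : 2 * n%:R * k = n%:R / k * 2 ^+ 8 * (k ^+ 2 / 128) by field; lra.
    by apply: ler_pM => //; lra.
  rewrite lnM ?posrE ?lnXn //; try lra.
  rewrite -/l -[ln 2 *+ 8]mulr_natr; lra.
rewrite (_ : 2 * 9 = 18) => [/(_ ln_le) H|]; last by ring.
have k3 : k ^+ 3 <= (8 * b%:R * e%:R) ^+ 3 by rewrite lerXn2r ?nnegrE; lra.
have bl : b%:R ^+ 2 <= (3 * l) ^+ 2 by rewrite lerXn2r ?nnegrE; lra.
have h1 := ler_wpM2l (sqr_ge0 b%:R) H.
have T0 : 0 <= 8 * expR 18 * t%:R :> R by rewrite !mulr_ge0 // expR_ge0.
have h2 := ler_wpM2r T0 bl.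
apply: le_trans k3 _.
have -> : (8 * b%:R * e%:R) ^+ 3 = 512 * (b%:R ^+ 2 * (e%:R ^+ 3 * b%:R)) :> R
  by ring.
lra.
Qed.

Theorem theorem6p19 (R : realType) (C : R) (hC : 1 <= C) :
  exists c : R, 0 < c /\
    forall (n : nat) (k : R), 1 <= k <= C * n%:R ->
    forall xs : nat -> fills R n, greedy_play xs ->
    forall (t : nat) (i : 'I_n), k <= xs t i ->
      c * (k + k ^+ 3 / (ln (n%:R / k + 2)) ^+ 2) <= t%:R.
Proof.
pose K : R := 192 ^+ 2 * expR 18.
have E1 : 1 <= expR 18 :> R by apply: le_trans (expR_ge1Dx _); lra.
have K1 : 192 ^+ 2 <= K by rewrite /K; lra.
exists (2 * K)^-1; split; first by rewrite invr_gt0; lra.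
move=> n k /andP[k1 _] xs pl t0 i0 k0.
(* Pass to the first time backlog k occurs, as [first_backlog_time] requires. *)
have ex : exists t, [exists i, k <= xs t i] by exists t0; apply/existsP; exists i0.
case: (ex_minnP ex) => t /existsP[i kx] min.
have tt0 : t%:R <= t0%:R :> R by rewrite ler_nat min //; apply/existsP; exists i0.
apply: le_trans tt0; rewrite mulrC ler_pdivrMr; last by lra.
have first s j : (s < t)%N -> xs s j < k.
  move=> st; rewrite ltNge; apply/negP => ks; move: st; rewrite ltnNge min //.
  by apply/existsP; exists j.
have kt : k <= t%:R by apply: le_trans kx (fill_le_time pl _ _).
suff cube : k ^+ 3 / ln (n%:R / k + 2) ^+ 2 <= K * t%:R by nra.
(* For k < 8, k^3 <= 64 t and l^2 >= 1/4 already suffice. *)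
have [k8|k8] := leP 8 k; first exact: first_backlog_time k8 pl kx first.
set l := ln _.
have nk0 : 0 <= n%:R / k by rewrite divr_ge0 //; lra.
have lh : 2^-1 <= l.
  by apply: le_trans (ln2_ge R) _; rewrite /l ler_ln ?posrE; lra.
have l4 : 4^-1 <= l ^+ 2 by nra.
rewrite ler_pdivrMr; last by lra.
have k2 : k ^+ 2 <= 64 by nra.
have : k ^+ 3 <= 64 * t%:R.
  by rewrite exprS mulrC ler_pM ?sqr_ge0; lra.
have Kt : 0 <= K * t%:R by rewrite mulr_ge0; lra.
have := ler_wpM2l Kt l4; nra.
Qed.
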